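(* Let $\mathcal{H}$ be a complex Hilbert space with orthonormal basis $\{e_n\}_{n\in\mathbb{N}}$, and let $T_1,T_2\in\mathcal{B}(\mathcal{H})$ be the bounded linear operators determined by $$T_1e_n=\begin{cases}e_{3n+1},& n \text{ odd},\\ 0,& n\text{ even},\end{cases}\qquad T_2e_n=\begin{cases}0,& n \text{ odd},\\ e_{n/2},& n\text{ even}.\end{cases}$$ The following are equivalent: (i) $C^{*}(T_1,T_2)$ has no non-trivial reducing subspaces; (ii) the Collatz conjecture holds.
   Context: $\mathbb{N}$ is the set of positive integers. The Collatz map $f:\mathbb{N}\to\mathbb{N}$ is $f(n)=3n+1$ for $n$ odd and $f(n)=n/2$ for $n$ even. The Collatz conjecture is the statement: for every $n\in\mathbb{N}$ there is an integer $m\ge 0$ with $f^m(n)=1$, where $f^m$ is the $m$-th iterate ($f^0=\mathrm{id}$). $\mathcal{B}(\mathcal{H})$ is the algebra of bounded linear operators on $\mathcal{H}$. A $C^*$-algebra in $\mathcal{B}(\mathcal{H})$ is a norm-closed linear subspace of $\mathcal{B}(\mathcal{H})$ closed under products and adjoints; $C^*(T_1,T_2)$ is the $C^*$-algebra generated by $T_1,T_2$, i.e. the smallest $C^*$-algebra in $\mathcal{B}(\mathcal{H})$ containing $T_1$ and $T_2$. A reducing subspace of a $C^*$-algebra $\mathcal{A}\subseteq\mathcal{B}(\mathcal{H})$ is a closed subspace $\mathcal{M}\subseteq\mathcal{H}$ with $S\mathcal{M}\subseteq\mathcal{M}$ and $S^*\mathcal{M}\subseteq\mathcal{M}$ for all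 $S\in\mathcal{A}$; the trivial ones are $\{0\}$ and $\mathcal{H}$. *)

(* Defs.v *)
From HB Require Import structures.
From mathcomp Require Import all_boot all_order all_algebra.
From mathcomp Require Import all_classical all_reals all_analysis.
From mathcomp Require Import complex.

Set Implicit Arguments.
Unset Strict Implicit.
Unset Printing Implicit Defensive.

Import Order.TTheory GRing.Theory Num.Theory.
Import numFieldNormedType.Exports.

Local Open Scope classical_set_scope.
Local Open Scope ring_scope.
Local Open Scope complex_scope.

(* Only the values at positive arguments matter; they are again positive. *)
Definition collatz (n : nat) : nat :=
  if odd n then (3 * n + 1)%N else n./2.

Definition collatz_conjecture : Prop :=
  forall n : nat, (0 < n)%N -> exists m : nat, iter m collatz n = 1%N.

Definition linear_subspace (K : numFieldType) (V : lmodType K) (M : set V) :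
    Prop :=
  M 0 /\ forall (a : K) (x y : V), M x -> M y -> M (a *: x + y).

Section Hilbert.
Variables (R : realType) (H : completeNormedModType R[i]).

(* A complex Hilbert space is a complete normed space over R[i] whose norm
   comes from an inner product, linear in its first argument. *)
Definition norm_of_inner (dot : {dot H for @Num.conj R[i]}) : Prop :=
  forall x : H, `|x| ^+ 2 = dot x x.

Variable dot : {dot H for @Num.conj R[i]}.

(* The family (e n) indexed by n in D is orthonormal with dense linear span;
   the values of e outside D are irrelevant. *)
Definition orthonormal_basis (D : set nat) (e : nat -> H) : Prop :=
  (forall m n, D m -> D n -> dot (e m) (e n) = (m == n)%:R) /\
  closure (smallest (@linear_subspace _ H) (e @` D)) = setT.

Definition bounded_operator (S : H -> H) : Prop :=
  linear S /\ exists M : R, forall x : H, `|S x| <= M%:C * `|x|.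

(* The norm of H takes its (real) values in R[i], where no sup is available. *)
Definition opnorm (S : H -> H) : R :=
  sup [set complex.Re `|S x| | x in [set x : H | `|x| <= 1]].

(* By the Riesz representation theorem every bounded operator S has exactly one
   adjoint S', which is itself bounded and linear. *)
Definition is_adjoint (S S' : H -> H) : Prop :=
  forall x y : H, dot (S x) y = dot x (S' y).

Definition norm_closed (A : set (H -> H)) : Prop :=
  forall S : H -> H, bounded_operator S ->
    (forall eps : R, 0 < eps -> exists2 T, A T & opnorm (S - T) < eps) -> A S.

Definition cstar_algebra (A : set (H -> H)) : Prop :=
  [/\ A `<=` bounded_operator,
      linear_subspace A,
      forall S T, A S -> A T -> A (S \o T),
      forall S S', A S -> is_adjoint S S' -> A S'
    & norm_closed A].

Definition cstar_generated (G : set (H -> H)) : set (H -> H) :=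
  smallest cstar_algebra G.

Definition reducing_subspace (A : set (H -> H)) (M : set H) : Prop :=
  [/\ linear_subspace M,
      closed M,
      forall S, A S -> S @` M `<=` M
    & forall S S', A S -> is_adjoint S S' -> S' @` M `<=` M].

Definition no_nontrivial_reducing_subspace (A : set (H -> H)) : Prop :=
  forall M : set H, reducing_subspace A M -> M = [set 0] \/ M = setT.

End Hilbert.

(* Main.v *)
Require Import Defs.
From HB Require Import structures.
From mathcomp Require Import all_boot all_order all_algebra.
From mathcomp Require Import all_classical all_reals all_analysis.
From mathcomp Require Import complex ring zify.
Import Order.TTheory GRing.Theory Num.Theory.
Import numFieldNormedType.Exports.
Local Open Scope classical_set_scope.
Local Open Scope ring_scope.
Local Open Scope complex_scope.

(* If some n never reaches 1, the closed span of the e_k with k reaching 1 is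
   invariant under T1 and T2, and so is its orthogonal complement, because
   "k reaches 1" and "f k reaches 1" are equivalent; hence it reduces the
   algebra.
   Conversely, the word W = T2 T2 T1 fixes e_1, and its powers converge
   strongly to the projection onto e_1: T1 and T2 are contractions, and W maps
   every other e_n to 0 or to some e_k with 1 < k < n. So a reducing subspace M
   contains e_1 or is orthogonal to it. Since T1* and T2* undo the Collatz map
   on the basis, the Collatz conjecture then gives that all e_n belong to M, or
   that all of them are orthogonal to M. *)

Set Implicit Arguments.
Unset Strict Implicit.
Unset Printing Implicit Defensive.

(** * Linear maps and linear subspaces *)

Section LinearMaps.
Context {K : numFieldType} {V W : lmodType K}.

Lemma lin0 (S : V -> W) : linear S -> S 0 = 0.
Proof. by move=> /(_ (-1) 0 0); rewrite scaler0 addr0 scaleN1r addNr. Qed.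

Lemma linD (S : V -> W) : linear S -> forall x y, S (x + y) = S x + S y.
Proof. by move=> lS x y; rewrite -[x in LHS]scale1r lS scale1r. Qed.

Lemma linZ (S : V -> W) : linear S -> forall a x, S (a *: x) = a *: S x.
Proof. by move=> lS a x; rewrite -[a *: x]addr0 lS lin0 // addr0. Qed.

Lemma linB (S : V -> W) : linear S -> forall x y, S (x - y) = S x - S y.
Proof. by move=> lS x y; rewrite linD // -scaleN1r linZ // scaleN1r. Qed.

Lemma lin_sum (S : V -> W) : linear S ->
  forall n (u : 'I_n -> V), S (\sum_i u i) = \sum_i S (u i).
Proof.
move=> lS n u; apply: (big_morph S); [exact: linD | exact: lin0].
Qed.

End LinearMaps.

Section Subspaces.
Context {K : numFieldType} {V : lmodType K} {M : set V}.
Hypothesis sM : linear_subspace M.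

Lemma subspaceZ a x : M x -> M (a *: x).
Proof. by case: sM => M0 Mlin Mx; rewrite -[a *: x]addr0; apply: Mlin. Qed.

End Subspaces.

Lemma smallest_subspace {K : numFieldType} {V : lmodType K} (G : set V) :
  linear_subspace (smallest (@linear_subspace K V) G).
Proof.
split=> [M [[M0 _] _] //|a x y sx sy M [sM GM]].
by apply: sM.2; [apply: sx | apply: sy].
Qed.

(** * Closures and closed subspaces of normed spaces *)

Section NormedSpace.
Context {K : numFieldType} {V : normedModType K}.
Implicit Types (A M : set V) (x : V).

Lemma closure_dist A x :
  closure A x <-> forall eps : K, 0 < eps -> exists2 y, A y & `|x - y| < eps.
Proof.
split=> [Ax eps eps0|Ax B /nbhs_ballP[eps /= eps0 epsB]].
  have [|y [Ay xy]] := Ax (ball x eps); first exact: nbhsx_ballx.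
  by exists y => //; rewrite -ball_normE in xy.
have [y Ay xy] := Ax _ eps0; exists y; split => //.
by apply: epsB; rewrite -ball_normE.
Qed.

Lemma closed_dist A : closed A ->
  forall x, (forall eps : K, 0 < eps -> exists2 y, A y & `|x - y| < eps) -> A x.
Proof. by move=> /closure_id {2}-> x /closure_dist. Qed.

Lemma dist_closed A :
  (forall x, (forall eps : K, 0 < eps -> exists2 y, A y & `|x - y| < eps) ->
    A x) -> closed A.
Proof.
move=> AP; apply/closure_id/seteqP; split; first exact: subset_closure.
by move=> x /closure_dist; apply: AP.
Qed.

Definition closed_subspace M := linear_subspace M /\ closed M.

Lemma closure_subspace M : linear_subspace M -> closed_subspace (closure M).
Proof.
move=> sM; split; last exact: closed_closure.
split=> [|a x y /closure_dist Mx /closure_dist My].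
  by apply: subset_closure; case: sM.
apply/closure_dist => eps eps0.
(* Adding 1 keeps the divisor positive when [a] is 0; the same device recurs below with operator
   bounds and norms. *)
have a0 : 0 < `|a| + 1 by rewrite ltr_wpDl.
have [|x' Mx' xx'] := Mx (eps / 2 / (`|a| + 1)); first by rewrite !divr_gt0.
have [|y' My' yy'] := My (eps / 2); first by rewrite !divr_gt0.
exists (a *: x' + y'); first by apply: sM.2.
rewrite opprD addrACA -scalerBr (le_lt_trans (ler_normD _ _)) //.
rewrite [ltRHS]splitr ler_ltD // normrZ.
rewrite (@le_trans _ _ ((`|a| + 1) * `|x - x'|)) ?ler_wpM2r ?lerDl //.
by rewrite mulrC -ler_pdivlMr // ltW.
Qed.

End NormedSpace.

(** Serves both operators on [H] and functionals into the scalars; with [N] the zero subspace it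
    says that kernels are closed. *)
Lemma closed_subspace_preimage {K : numFieldType} {V W : normedModType K}
    (S : V -> W) (N : set W) (k : K) :
  linear S -> 0 <= k -> (forall x, `|S x| <= k * `|x|) ->
  closed_subspace N -> closed_subspace (S @^-1` N).
Proof.
move=> lS k0 Sk [sN cN]; split.
  split=> [|a x y Nx Ny] /=; first by rewrite lin0 //; case: sN.
  by rewrite lS; apply: sN.2.
apply: dist_closed => x Nx; apply: (closed_dist cN (x := S x)) => eps eps0.
have k1 : 0 < k + 1 by rewrite ltr_wpDl.
have [|y Ny xy] := Nx (eps / (k + 1)); first by rewrite divr_gt0.
exists (S y) => //; rewrite -linB // (le_lt_trans (Sk _)) //.
rewrite (@le_lt_trans _ _ ((k + 1) * `|x - y|)) ?ler_wpM2r ?lerDl //.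
by rewrite mulrC -ltr_pdivlMr.
Qed.

Lemma closed_subspace0 {K : numFieldType} {V : normedModType K} :
  closed_subspace [set 0 : V].
Proof.
split; first by split=> [|a x y /= -> ->]; rewrite ?scaler0 ?addr0.
apply: dist_closed => x x0; apply/eqP; rewrite -normr_le0.
apply/ler_addgt0Pr => eps eps0; rewrite add0r.
by have [y -> xy] := x0 _ eps0; rewrite subr0 in xy; exact: ltW.
Qed.

(** * Inner products, bounded operators and the operator norm *)

Section Hilbert.
Context {R : realType} {H : completeNormedModType R[i]}.
Variable dot : {dot H for @Num.conj R[i]}.

Local Notation C := (R[i]).
Implicit Types (x y z : H) (S T : H -> H).

Lemma dotDZl a x y z : dot (a *: x + y) z = a * dot x z + dot y z.
Proof. by rewrite linearDl linearZl. Qed.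

Lemma dotDZr a x y z : dot z (a *: x + y) = Num.conj a * dot z x + dot z y.
Proof. by rewrite linearDr linearZ_LR. Qed.

Lemma dotC x y : dot x y = Num.conj (dot y x).
Proof. by rewrite hermC mul1r. Qed.

Lemma dot_eq0C x y : dot x y = 0 -> dot y x = 0.
Proof. by rewrite [dot y x]dotC => ->; rewrite conjC0. Qed.

Lemma dot_injr x y : (forall z, dot z x = dot z y) -> x = y.
Proof.
move=> xy; apply/eqP; rewrite -subr_eq0 -(dnorm_eq0 dot) linearB /= xy.
by rewrite subrr.
Qed.

Lemma adjointC S S' : is_adjoint dot S S' -> is_adjoint dot S' S.
Proof. by move=> SS' x y; rewrite dotC -SS' -dotC. Qed.

Lemma adjoint_linear S S' : is_adjoint dot S S' -> linear S'.
Proof.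
move=> SS' a x y; apply: dot_injr => z.
by rewrite -SS' !dotDZr !SS'.
Qed.

Section InnerNorm.
Hypothesis Hdot : norm_of_inner dot.

Lemma cauchy_schwarz x y : `|dot x y| <= `|x| * `|y|.
Proof.
have [->|y0] := eqVneq y 0; first by rewrite linear0 !normr0 mulr0.
have n0 : 0 < dot y y by rewrite dnorm_gt0.
rewrite -ler_sqr ?nnegrE ?mulr_ge0 // exprMn !Hdot.
set n := dot y y; set d := dot x y.
(* This vector is [n] times the component of [x] orthogonal to [y]; the scaling avoids a division.
   Its square norm is n (n |x|^2 - |d|^2). *)
have := dnorm_ge0 dot (n *: x + (- d) *: y).
rewrite dotDZl !dotDZr /= !linearZ_LR /= -/n -/d.
have -> : dot ((- d) *: y) x = - d * Num.conj d.
  by rewrite linearZl /= [dot y x]dotC.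
have -> : dot ((- d) *: y) y = - d * n by rewrite linearZl.
have -> : Num.conj n = n by apply: geC0_conj; apply: ltW.
rewrite (_ : _ + _ = n * (n * dot x x - d * Num.conj d));
  last by rewrite rmorphN; ring.
by rewrite pmulr_rge0 // subr_ge0 normCK [n * _]mulrC.
Qed.

Lemma pythagoras x y : dot x y = 0 -> `|x + y| ^+ 2 = `|x| ^+ 2 + `|y| ^+ 2.
Proof.
by move=> xy; rewrite !Hdot dnormD xy conjC0 !addr0.
Qed.

Lemma norm_le_pythagoras x y : dot x y = 0 -> `|x| <= `|x + y|.
Proof.
by move=> xy; rewrite -ler_sqr ?nnegrE // pythagoras // lerDl exprn_ge0.
Qed.

Lemma closed_subspace_orthogonal y :
  closed_subspace [set x : H | dot x y = 0].
Proof.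
have := @closed_subspace_preimage _ H C^o (dot^~ y) [set 0] `|y|.
apply => //; last exact: closed_subspace0.
- by move=> a u v; rewrite dotDZl.
- by move=> x; rewrite mulrC; exact: cauchy_schwarz.
Qed.

(** Moves the bound into [R[i]], where norms live, and makes it non-negative so that bounds can be
    multiplied. *)
Lemma bounded_operatorP S : bounded_operator S <->
  linear S /\ exists2 k : C, 0 <= k & forall x, `|S x| <= k * `|x|.
Proof.
split=> [[lS [m Sm]]|[lS [k k0 Sk]]]; split => //.
  exists `|m%:C| => // x; apply: (le_trans (Sm x)).
  by rewrite ler_wpM2r // real_ler_norm // complex_real.
by exists (complex.Re k) => x; rewrite RRe_real // ger0_real.
Qed.

Lemma bounded_linear S : bounded_operator S -> linear S.
Proof. by case. Qed.

Lemma bounded_preimage S (N : set H) :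
  bounded_operator S -> closed_subspace N -> closed_subspace (S @^-1` N).
Proof.
by move=> /bounded_operatorP[lS [k k0 Sk]]; exact: closed_subspace_preimage Sk.
Qed.

Lemma bounded_comb a S T : bounded_operator S -> bounded_operator T ->
  bounded_operator (a *: S + T).
Proof.
move=> /bounded_operatorP[lS [k k0 Sk]] /bounded_operatorP[lT [l l0 Tl]].
apply/bounded_operatorP; split=> [b x y|].
  rewrite -![(_ + _ : H -> H) _]/(a *: S _ + T _) lS lT !scalerDr !scalerA.
  by rewrite [a * b]mulrC addrACA.
exists (`|a| * k + l) => [|x]; first by rewrite addr_ge0 // mulr_ge0.
rewrite -[(_ + _ : H -> H) _]/(a *: S _ + T _) (le_trans (ler_normD _ _)) //.
by rewrite mulrDl lerD // normrZ -mulrA ler_wpM2l.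
Qed.

Lemma bounded_comp S T : bounded_operator S -> bounded_operator T ->
  bounded_operator (S \o T).
Proof.
move=> /bounded_operatorP[lS [k k0 Sk]] /bounded_operatorP[lT [l l0 Tl]].
apply/bounded_operatorP; split=> [b x y /=|]; first by rewrite lT lS.
exists (k * l) => [|x /=]; first exact: mulr_ge0.
by rewrite (le_trans (Sk _)) // -mulrA ler_wpM2l.
Qed.

Lemma bounded0 : bounded_operator (0 : H -> H).
Proof.
split=> [a x y|]; first by rewrite /= scaler0 addr0.
by exists 0 => x; rewrite normr0 mul0r.
Qed.

Lemma bounded_id : bounded_operator (id : H -> H).
Proof. by split=> //; exists 1 => x; rewrite mul1r. Qed.

Lemma adjoint_bounded S S' :
  bounded_operator S -> is_adjoint dot S S' -> bounded_operator S'.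
Proof.
move=> /bounded_operatorP[lS [k k0 Sk]] SS'; apply/bounded_operatorP.
split; first exact: adjoint_linear SS'.
exists k => // x; have [->|S'x0] := eqVneq (S' x) 0.
  by rewrite normr0 mulr_ge0.
have n0 : 0 < `|S' x| by rewrite normr_gt0.
(* |S' x|^2 = <S S' x, x> <= k |S' x| |x|, and |S' x| cancels. *)
rewrite -(ler_pM2l n0) -expr2 Hdot -SS' mulrCA mulrA.
rewrite (le_trans (real_ler_norm _)) ?ger0_real ?SS' ?dnorm_ge0 // -SS'.
by rewrite (le_trans (cauchy_schwarz _ _)) // ler_wpM2r.
Qed.

Lemma le_opnorm S y : bounded_operator S -> `|y| <= 1 ->
  `|S y| <= (opnorm S)%:C.
Proof.
move=> /bounded_operatorP[lS [k k0 Sk]] y1.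
have ReE z : (complex.Re `|z|)%:C = `|z| by rewrite RRe_real // ger0_real.
(* [sup] dominates its set only if the set is bounded above; the constant [k] supplies that
   bound. *)
rewrite -ReE lecR; apply: ub_le_sup; last by exists y.
exists (complex.Re k) => _ [z /= z1 <-]; rewrite -lecR ReE.
by rewrite RRe_real ?ger0_real // (le_trans (Sk _)) // ler_piMr.
Qed.

Lemma opnorm_ge0 S : bounded_operator S -> 0 <= opnorm S.
Proof.
move=> bS; rewrite -ler0c -[leLHS](normr0 H) -(lin0 bS.1).
by apply: le_opnorm => //; rewrite normr0.
Qed.

Lemma opnorm_bound S x : bounded_operator S -> `|S x| <= (opnorm S)%:C * `|x|.
Proof.
move=> bS; have [->|x0] := eqVneq x 0.
  by rewrite (lin0 bS.1) !normr0 mulr0.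
rewrite -ler_pdivrMr ?normr_gt0 // mulrC -[`|x|^-1]ger0_norm ?invr_ge0 //.
rewrite -normrZ -(linZ bS.1).
apply: le_opnorm => //.
by rewrite normrZ ger0_norm ?invr_ge0 // mulVf ?normr_eq0.
Qed.

End InnerNorm.
End Hilbert.

(** * Closed spans of parts of an orthonormal basis *)

Section Basis.
Context {R : realType} {H : completeNormedModType R[i]}.
Variable dot : {dot H for @Num.conj R[i]}.
Hypothesis Hdot : norm_of_inner dot.
Variable e : nat -> H.

Local Notation C := (R[i]).
Implicit Types (x y z : H) (S T : H -> H) (P Q : set nat).

Definition family_span P := smallest (@linear_subspace _ H) (e @` P).

Lemma mem_span P n : P n -> family_span P (e n).
Proof. by move=> Pn M [_ +]; apply; exists n. Qed.

Lemma span_min P (M : set H) :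
  linear_subspace M -> (forall n, P n -> M (e n)) -> family_span P `<=` M.
Proof. by move=> sM eM; apply: smallest_sub => // _ [n Pn <-]; exact: eM. Qed.

Lemma closure_span_min P (M : set H) :
  closed_subspace M -> (forall n, P n -> M (e n)) ->
  closure (family_span P) `<=` M.
Proof.
move=> [sM /closure_id cM] eM; rewrite [X in _ `<=` X]cM.
by apply: closureS; exact: span_min.
Qed.

Lemma closed_subspace_span P : closed_subspace (closure (family_span P)).
Proof. exact/closure_subspace/smallest_subspace. Qed.

Lemma closure_span_stable P S : bounded_operator S ->
  (forall n, P n -> closure (family_span P) (S (e n))) ->
  closure (family_span P) `<=` S @^-1` closure (family_span P).
Proof.
move=> bS Se; apply: closure_span_min => //.
by apply: bounded_preimage => //; exact: closed_subspace_span.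
Qed.

Local Notation pos := [set n | (0 < n)%N].
Hypothesis He : orthonormal_basis dot pos e.

Lemma dot_basis m n : (0 < m)%N -> (0 < n)%N -> dot (e m) (e n) = (m == n)%:R.
Proof. by case: He => + _; apply. Qed.

Lemma norm_basis n : (0 < n)%N -> `|e n| = 1.
Proof.
move=> n0; apply/eqP; rewrite -(@eqrXn2 _ 2) // expr1n Hdot dot_basis //.
by rewrite eqxx.
Qed.

(** The density principle behind the extension arguments below: show that a property cuts out a
    closed subspace, then check it on the basis. *)
Lemma basis_total (M : set H) :
  closed_subspace M -> (forall n, (0 < n)%N -> M (e n)) -> M = setT.
Proof.
move=> cM eM; apply/seteqP; split => // x _.
by apply: (@closure_span_min pos) => //; rewrite /family_span He.2.
Qed.

Lemma basis_ext S T : bounded_operator S -> bounded_operator T ->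
  (forall n, (0 < n)%N -> S (e n) = T (e n)) -> S =1 T.
Proof.
move=> bS bT ST x; apply/eqP; rewrite -subr_eq0; apply/eqP.
have bST : bounded_operator ((-1) *: T + S) by exact: bounded_comb.
have /basis_total E := bounded_preimage bST closed_subspace0.
suff : (((-1) *: T + S) @^-1` [set 0]) x by rewrite /= addrC scaleN1r.
by rewrite E // => n n0 /=; rewrite [LHS]addrC [X in _ + X]scaleN1r ST // subrr.
Qed.

(** The difference is orthogonal to every basis vector, hence to all of [H], hence to itself. *)
Lemma basis_dot_ext x y :
  (forall n, (0 < n)%N -> dot x (e n) = dot y (e n)) -> x = y.
Proof.
move=> xy; apply/eqP; rewrite -subr_eq0 -(dnorm_eq0 dot); apply/eqP/dot_eq0C.
have /basis_total E := closed_subspace_orthogonal Hdot (x - y).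
suff : [set z | dot z (x - y) = 0] (x - y) by [].
rewrite E // => n n0 /=; apply: dot_eq0C.
by rewrite linearBl /= xy ?subrr.
Qed.

Lemma disjoint_span_dot0 P Q : P `<=` pos -> Q `<=` pos -> P `&` Q = set0 ->
  forall x y, closure (family_span P) x -> closure (family_span Q) y ->
  dot x y = 0.
Proof.
move=> Ppos Qpos PQ x y Px Qy; move: x Px; apply: closure_span_min.
  exact: closed_subspace_orthogonal.
(* The first argument is now a basis vector; the same density argument is repeated in the second. *)
move=> m Pm /=; apply: dot_eq0C; move: y Qy; apply: closure_span_min.
  exact: closed_subspace_orthogonal.
move=> n Qn /=; rewrite dot_basis; [|exact: Qpos|exact: Ppos].
case: eqP => // nm; suff : set0 m by [].
by rewrite -PQ; split => //; rewrite -nm.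
Qed.

(* Pythagoras: if [u + v] approximates [y], with [u] in the span of [P] and [v]
   orthogonal to [u] and [y], then [u] is at least as good an approximation. *)
Lemma closure_span_orthogonal P : P `<=` pos ->
  closure (family_span P) =
  [set x | forall n, (0 < n)%N -> ~ P n -> dot x (e n) = 0].
Proof.
move=> Ppos; have disj : P `&` (pos `\` P) = set0.
  by rewrite setDE setICA setICr setI0.
have Qpos : pos `\` P `<=` pos by move=> n [].
apply/seteqP; split=> [x Px n n0 Pn|y yP].
  apply: (disjoint_span_dot0 Ppos Qpos disj) => //.
  apply/subset_closure; exact: mem_span.
have Qy v : family_span (pos `\` P) v -> dot y v = 0.
  move=> Qv; apply: dot_eq0C; move: v Qv; apply: span_min.
    by have [] := closed_subspace_orthogonal Hdot y.
  by move=> n [n0 nPn] /=; apply: dot_eq0C; exact: yP.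
(* Only finite combinations are split here; being dense, they suffice to approximate [y]. *)
have decomp : family_span pos `<=` [set z | exists u v,
    [/\ family_span P u, family_span (pos `\` P) v & z = u + v]].
  apply: span_min => [|n n0].
    split=> [|a _ _ [u [v [Pu Qv ->]]] [u' [v' [Pu' Qv' ->]]]].
      by exists 0, 0; rewrite addr0; split=> //; apply: (smallest_subspace _).1.
    exists (a *: u + u'), (a *: v + v'); split.
    - exact: (smallest_subspace _).2.
    - exact: (smallest_subspace _).2.
    - by rewrite scalerDr addrACA.
  have span0 Q : family_span Q 0 by apply: (smallest_subspace _).1.
  have [Pn|Pn] := pselect (P n).
    by exists (e n), 0; rewrite addr0; split => //; exact: mem_span.
  by exists 0, (e n); rewrite add0r; split => //; exact: mem_span.
have : closure (family_span pos) y by rewrite /family_span He.2.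
move=> /closure_dist yspan; apply/closure_dist => eps eps0.
have [_ /decomp[u [v [Pu Qv ->]]] yuv] := yspan _ eps0.
exists u => //; apply: le_lt_trans yuv; rewrite opprD addrA.
apply: norm_le_pythagoras => //.
rewrite linearN /= linearBl /= Qy //
  (disjoint_span_dot0 Ppos Qpos disj) ?subrr ?oppr0 //.
- exact: subset_closure.
- exact: subset_closure.
Qed.

End Basis.

(** * Existence of adjoints, and contractivity of partial isometries *)

Section Adjoint.
Context {R : realType} {H : completeNormedModType R[i]}.
Variable dot : {dot H for @Num.conj R[i]}.
Hypothesis Hdot : norm_of_inner dot.
Variable e : nat -> H.
Hypothesis He : orthonormal_basis dot [set n | (0 < n)%N] e.
Local Notation C := (R[i]).
Implicit Types (x y z : H) (S T : H -> H).

(** With [T] the identity and [z] the candidate for S* y, this extends the adjoint relation from the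
    basis to [H]. *)
Lemma basis_form_ext S T y z : bounded_operator S -> bounded_operator T ->
  (forall n, (0 < n)%N -> dot (S (e n)) y = dot (T (e n)) z) ->
  forall x, dot (S x) y = dot (T x) z.
Proof.
move=> bS bT ST x; apply/eqP; rewrite -subr_eq0; apply/eqP.
have /bounded_operatorP[lS [k k0 Sk]] := bS.
have /bounded_operatorP[lT [l l0 Tl]] := bT.
pose f x : C^o := dot (S x) y - dot (T x) z.
suff /(basis_total He) E : closed_subspace (f @^-1` [set 0]).
  suff : (f @^-1` [set 0]) x by [].
  by rewrite E // => n n0; rewrite /f /= ST // subrr.
apply: (@closed_subspace_preimage _ _ _ f _ (k * `|y| + l * `|z|)).
- by move=> a u v; rewrite /f lS lT !dotDZl scalerBr opprD addrACA.
- by rewrite addr_ge0 // mulr_ge0.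
- move=> u; rewrite mulrDl (le_trans (ler_normB _ _)) // lerD //.
  + by rewrite (le_trans (cauchy_schwarz Hdot _ _)) // mulrAC ler_wpM2r.
  + by rewrite (le_trans (cauchy_schwarz Hdot _ _)) // mulrAC ler_wpM2r.
- exact: closed_subspace0.
Qed.

Lemma dot_psum (c : nat -> C) N n :
  dot (\sum_(i < N) c i *: e i.+1) (e n.+1) = if (n < N)%N then c n else 0.
Proof.
elim: N => [|N IH]; first by rewrite big_ord0 linear0l.
rewrite big_ord_recr /= addrC dotDZl (dot_basis He) // IH eqSS ltnS eq_sym.
by case: ltngtP => [||->]; rewrite ?mulr0 ?add0r // mulr1 addr0.
Qed.

(** The square norms of the partial sums increase and are bounded, and their differences are the
    squared distances of the sums; so the sums form a Cauchy sequence, and [w] is its limit.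
    Coefficient [n] belongs to [e n.+1] because the basis starts at 1. *)
Lemma riesz_fischer (c : nat -> C) (k : C) :
  (forall N, `|\sum_(i < N) c i *: e i.+1| <= k) ->
  exists w, forall n, dot w (e n.+1) = c n.
Proof.
set z := fun N : nat => \sum_(i < N) c i *: e i.+1 => zk.
have zS N : z N.+1 = c N *: e N.+1 + z N by rewrite /z big_ord_recr addrC.
have dot_z N n := dot_psum c N n.
have dot_zz M d : dot (z M) (z (M + d)%N) = dot (z M) (z M).
  elim: d => [|d IH]; first by rewrite addn0.
  by rewrite addnS zS dotDZr IH dot_z ltnNge leq_addr mulr0 add0r.
have z_diff M N : (M <= N)%N -> `|z M - z N| ^+ 2 = `|z N| ^+ 2 - `|z M| ^+ 2.
  move=> /subnKC <-; set d := (N - M)%N; rewrite !Hdot dnormB dot_zz.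
  rewrite geC0_conj ?dnorm_ge0 //; ring.
(* The square norms are moved to [R], where suprema exist. *)
pose s N := complex.Re (`|z N| ^+ 2).
have sE N : (s N)%:C = `|z N| ^+ 2 by rewrite RRe_real // ger0_real ?exprn_ge0.
have hs : has_sup (range s).
  split; first by exists (s 0%N), 0%N.
  exists (complex.Re (k ^+ 2)) => _ [N _ <-]; rewrite -lecR sE.
  have k0 : 0 <= k by exact: le_trans (zk 0%N).
  by rewrite RRe_real ?ger0_real ?exprn_ge0 // ler_sqr ?nnegrE //; exact: zk.
have /cauchy_cvg/cvg_ex[/= w zw] : cauchy (z @ \oo).
  apply: cauchy_exP => eps eps0.
  have epsE : (complex.Re (eps ^+ 2))%:C = eps ^+ 2.
    by rewrite RRe_real // gtr0_real ?exprn_gt0.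
  have eps20 : 0 < complex.Re (eps ^+ 2) by rewrite -ltcR epsE exprn_gt0.
  (* From [M] on, the square norms stay within eps^2 of their supremum. *)
  have [_ [M _ <-] sM] := sup_adherent eps20 hs.
  exists (z M), M => //= N /= MN.
  rewrite -ball_normE /= -ltr_sqr ?nnegrE ?(ltW eps0) // z_diff //.
  rewrite -epsE -!sE -rmorphB ltcR ltrBlDr.
  apply: (le_lt_trans (ub_le_sup hs.2 _)); first by exists N.
  by rewrite -ltrBlDl.
exists w => n; apply/eqP; rewrite -subr_eq0 -normr_le0.
apply/ler_addgt0Pr => eps eps0; rewrite add0r.
have /cvgrPdist_lt/(_ _ eps0)[N _ zN] := zw.
(* The index [N + n.+1] is late enough both to be close to [w] and to have picked up the coefficient
   [c n]. *)
have -> : c n = dot (z (N + n.+1)%N) (e n.+1).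
  by rewrite dot_z leq_addl.
rewrite -linearBl (le_trans (cauchy_schwarz Hdot _ _)) //.
rewrite (norm_basis Hdot He) // mulr1 ltW //; apply: zN.
exact: leq_addr.
Qed.

Lemma adjoint_exists S : bounded_operator S -> exists S', is_adjoint dot S S'.
Proof.
move=> bS; have /bounded_operatorP[lS [k k0 Sk]] := bS.
suff /choice[S' SS'] y : exists w, forall n, (0 < n)%N ->
    dot (S (e n)) y = dot (e n) w.
  exists S' => x y; apply: (basis_form_ext bS bounded_id (SS' y)).
(* These are the coefficients that S* y must have. A partial sum [z] satisfies |z|^2 = <y, S z> <= k
   |y| |z|, which bounds |z|. *)
pose c n := dot y (S (e n.+1)).
have [N|w wc] := @riesz_fischer c (k * `|y|).
  set z := \sum_(i < N) _; have [->|z0] := eqVneq z 0.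
    by rewrite normr0 mulr_ge0.
  have n0 : 0 < `|z| by rewrite normr_gt0.
  rewrite -(ler_pM2l n0) -expr2 Hdot.
  have zz : dot z z = dot y (S z).
    rewrite {2 3}/z (lin_sum lS) !raddf_sum /=; apply: eq_bigr => i _.
    by rewrite (linZ lS) !linearZ_LR /= dot_psum ltn_ord.
  apply: (@le_trans _ _ `|dot y (S z)|).
    by rewrite zz real_ler_norm // -zz ger0_real ?dnorm_ge0.
  rewrite (le_trans (cauchy_schwarz Hdot _ _)) // mulrA [leRHS]mulrC.
  by rewrite ler_wpM2l // mulrC.
exists w => -[|n] // _.
by rewrite dotC -[dot y _]/(c n) -wc -dotC.
Qed.

(** From S S* S = S follows |S* S x| = |S x|, so |S x|^2 = <x, S* S x> <= |x| |S x|. *)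
Lemma partial_isometry_contraction S S' : bounded_operator S ->
  is_adjoint dot S S' -> (forall n, (0 < n)%N -> S (S' (S (e n))) = S (e n)) ->
  forall x, `|S x| <= `|x|.
Proof.
move=> bS SS' SSSe x.
have bS' := adjoint_bounded Hdot bS SS'.
have SSS : S \o (S' \o S) =1 S.
  by apply: (basis_ext He) => //; do 2! apply: bounded_comp => //.
have normE : `|S' (S x)| = `|S x|.
  apply/eqP; rewrite -(@eqrXn2 _ 2) // !Hdot -SS'.
  by rewrite -[S (S' (S x))]/((S \o (S' \o S)) x) SSS.
have [->|Sx0] := eqVneq (S x) 0; first by rewrite normr0.
rewrite -(@ler_pM2r _ `|S x|) ?normr_gt0 // -expr2 Hdot SS'.
rewrite -[X in _ <= _ * X]normE (le_trans _ (cauchy_schwarz Hdot _ _)) //.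
by rewrite real_ler_norm // -SS' ger0_real // dnorm_ge0.
Qed.

End Adjoint.

(** * Operators preserving a subspace and its orthogonal complement *)

Section Stabilizer.
Context {R : realType} {H : completeNormedModType R[i]}.
Variable dot : {dot H for @Num.conj R[i]}.
Hypothesis Hdot : norm_of_inner dot.
Variables M N : set H.
Hypotheses (cM : closed_subspace M) (cN : closed_subspace N).
Hypothesis MP : forall x, M x <-> forall y, N y -> dot x y = 0.
Hypothesis NP : forall x, N x <-> forall y, M y -> dot x y = 0.
Implicit Types (S T : H -> H) (L : set H).

Definition stabilizer L : set (H -> H) :=
  [set S | bounded_operator S /\ forall x, L x -> L (S x)].

Lemma stabilizer_subspace L : linear_subspace L ->
  linear_subspace (stabilizer L).
Proof.
move=> sL; split; first by split=> [|x Lx]; [exact: bounded0 | case: sL].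
move=> a S T [bS LS] [bT LT]; split; first exact: bounded_comb.
by move=> x Lx; apply: sL.2; [apply: LS | apply: LT].
Qed.

Lemma stabilizer_closed L : closed L -> norm_closed (stabilizer L).
Proof.
move=> cL S bS Sapprox; split=> // x Lx; apply: (closed_dist cL) => eps eps0.
have x1 : 0 < `|x| + 1 by rewrite ltr_wpDl.
have q0 : 0 < eps / (`|x| + 1) by rewrite divr_gt0.
have qE : (complex.Re (eps / (`|x| + 1)))%:C = eps / (`|x| + 1).
  by rewrite RRe_real // gtr0_real.
have [|T [bT LT] ST] := Sapprox (complex.Re (eps / (`|x| + 1))).
  by rewrite -ltcR qE.
exists (T x); first exact: LT.
have bST : bounded_operator (S - T).
  by rewrite addrC -scaleN1r; exact: bounded_comb.
apply: (le_lt_trans (opnorm_bound x bST)).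
apply: (@le_lt_trans _ _ ((opnorm (S - T))%:C * (`|x| + 1))).
  by rewrite ler_wpM2l ?lerDl // lecR opnorm_ge0.
by rewrite -ltr_pdivlMr // -qE ltcR.
Qed.

(** Since <y, S' x> = <S y, x>, preserving one of two complementary subspaces makes the adjoint
    preserve the other. *)
Lemma stabilizer_adjoint S S' : bounded_operator S -> is_adjoint dot S S' ->
  (forall x, N x -> N (S x)) -> forall x, M x -> M (S' x).
Proof.
move=> bS SS' NS x Mx; apply/MP => y Ny; apply: dot_eq0C.
by rewrite -SS'; apply: (NP _).1 => //; apply: NS.
Qed.

End Stabilizer.

Section Reducing.
Context {R : realType} {H : completeNormedModType R[i]}.
Variable dot : {dot H for @Num.conj R[i]}.
Hypothesis Hdot : norm_of_inner dot.
Implicit Types (S T : H -> H) (M N : set H).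

(** Taking adjoints exchanges the two stabilizers, so their intersection is closed under
    adjoints. *)
Lemma stabilizer_cstar M N : closed_subspace M -> closed_subspace N ->
  (forall x, M x <-> forall y, N y -> dot x y = 0) ->
  (forall x, N x <-> forall y, M y -> dot x y = 0) ->
  cstar_algebra dot (stabilizer M `&` stabilizer N).
Proof.
move=> [sM cM] [sN cN] MP NP; split.
- by move=> S [[]].
- have [M0 Mlin] := stabilizer_subspace sM.
  have [N0 Nlin] := stabilizer_subspace sN.
  split; first by split.
  by move=> a S T [MS NS] [MT NT]; split; [exact: Mlin | exact: Nlin].
- move=> S T [[bS MS] [_ NS]] [[bT MT] [_ NT]].
  have bST := bounded_comp bS bT.
  by split; split => // x Lx; [apply/MS/MT | apply/NS/NT].
- move=> S S' [[bS MS] [_ NS]] SS'; have bS' := adjoint_bounded Hdot bS SS'.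
  by split; split => //; apply: stabilizer_adjoint SS' _ => //.
- move=> S bS Sapprox; split; apply: stabilizer_closed => // eps /Sapprox.
    by move=> [T [MT NT] ST]; exists T.
  by move=> [T [MT NT] ST]; exists T.
Qed.

(** By minimality of the generated algebra, reduction need only be checked on the generators, as
    invariance of [M] and of its complement [N]. *)
Lemma stabilizer_reducing M N (G : set (H -> H)) :
  closed_subspace M -> closed_subspace N ->
  (forall x, M x <-> forall y, N y -> dot x y = 0) ->
  (forall x, N x <-> forall y, M y -> dot x y = 0) ->
  G `<=` stabilizer M -> G `<=` stabilizer N ->
  reducing_subspace dot (cstar_generated dot G) M.
Proof.
move=> cM cN MP NP GM GN.
have GMN : cstar_generated dot G `<=` stabilizer M `&` stabilizer N.
  apply: smallest_sub; first exact: stabilizer_cstar.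
  by move=> S GS; split; [apply: GM | apply: GN].
split; [by case: cM|by case: cM| |].
  by move=> S /GMN[[_ MS] _] _ [x Mx <-]; apply: MS.
move=> S S' /GMN[[bS _] [_ NS]] SS' _ [x Mx <-].
exact: stabilizer_adjoint SS' _ _ _.
Qed.

End Reducing.

(** * The Collatz operators and the two implications *)

Section CollatzOperators.
Context {R : realType} {H : completeNormedModType R[i]}.
Variable dot : {dot H for @Num.conj R[i]}.
Hypothesis Hdot : norm_of_inner dot.
Variable e : nat -> H.
Hypothesis He : orthonormal_basis dot [set n | (0 < n)%N] e.
Implicit Types (x y z : H) (S T : H -> H) (n m N : nat).

(** The coefficient of T' e_(f n) at e_k is <e_(f n), T e_k>, which is non-zero only if [p k] and f
    k = f n, that is k = n by injectivity. *)
Lemma shift_adjoint (f : nat -> nat) (p : pred nat) T T' n :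
  (forall n, (0 < n)%N -> (0 < f n)%N) ->
  {in [pred n | p n & (0 < n)%N] &, injective f} ->
  (forall n, (0 < n)%N -> T (e n) = if p n then e (f n) else 0) ->
  is_adjoint dot T T' -> (0 < n)%N -> p n -> T' (e (f n)) = e n.
Proof.
move=> f0 fI Te TT' n0 pn; apply: (basis_dot_ext Hdot He) => k k0.
rewrite (adjointC TT') Te // (dot_basis He) //; case: ifPn => pk.
  rewrite (dot_basis He) ?f0 //; congr (nat_of_bool _)%:R.
  by apply: (inj_in_eq fI); rewrite inE ?pk ?pn.
by rewrite linear0; case: eqP => // nk; rewrite -nk pn in pk.
Qed.

Lemma shift_contraction (f : nat -> nat) (p : pred nat) T :
  (forall n, (0 < n)%N -> (0 < f n)%N) ->
  {in [pred n | p n & (0 < n)%N] &, injective f} ->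
  (forall n, (0 < n)%N -> T (e n) = if p n then e (f n) else 0) ->
  bounded_operator T -> forall x, `|T x| <= `|x|.
Proof.
move=> f0 fI Te bT; have [T' TT'] := adjoint_exists Hdot He bT.
apply: (partial_isometry_contraction Hdot He bT TT') => n n0.
have lT' := adjoint_linear TT'.
rewrite Te //; case: ifPn => pn; last by rewrite (lin0 lT') (lin0 bT.1).
by rewrite (shift_adjoint f0 fI Te TT') // Te // pn.
Qed.

Variables T1 T2 : H -> H.
Hypotheses (bT1 : bounded_operator T1) (bT2 : bounded_operator T2).
Hypothesis T1e : forall n : nat, (0 < n)%N ->
  T1 (e n) = if odd n then e (3 * n + 1)%N else 0.
Hypothesis T2e : forall n : nat, (0 < n)%N ->
  T2 (e n) = if odd n then 0 else e n./2.

Lemma collatz_gt0 n : (0 < n)%N -> (0 < collatz n)%N.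
Proof. by rewrite /collatz; case: ifP; lia. Qed.

Definition reaches1 (n : nat) := exists m, iter m collatz n = 1%N.

Lemma reaches1_collatz n : reaches1 (collatz n) <-> reaches1 n.
Proof.
split=> [[m]|[[/= ->|m]]]; first by rewrite -iterSr; exists m.+1.
  (* For n = 1 the orbit goes once round the cycle: [collatz 1] is 4, which needs two more steps. *)
  by exists 2%N.
by rewrite iterSr; exists m.
Qed.

Lemma T1_basis n : (0 < n)%N -> T1 (e n) = if odd n then e (collatz n) else 0.
Proof. by move=> n0; rewrite T1e // /collatz; case: ifP. Qed.

Lemma T2_basis n : (0 < n)%N -> T2 (e n) = if odd n then 0 else e (collatz n).
Proof. by move=> n0; rewrite T2e // /collatz; case: ifP. Qed.

Lemma span_collatz_stable (P : set nat) : P `<=` [set n | (0 < n)%N] ->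
  (forall n, P n -> P (collatz n)) ->
  [set T1; T2] `<=` stabilizer (closure (family_span e P)).
Proof.
move=> Ppos Pcollatz.
have cl0 : closure (family_span e P) 0.
  by case: (closed_subspace_span e P) => -[].
have clP n : P n -> closure (family_span e P) (e (collatz n)).
  by move=> Pn; apply: subset_closure; apply: mem_span; exact: Pcollatz.
move=> _ [->|->]; split => //; apply: closure_span_stable => // n Pn.
  by rewrite T1_basis //; [case: ifP => // _; apply: clP | apply: Ppos].
by rewrite T2_basis //; [case: ifP => // _; apply: clP | apply: Ppos].
Qed.

Lemma irreducible_collatz :
  no_nontrivial_reducing_subspace dot (cstar_generated dot [set T1; T2]) ->
  collatz_conjecture.
Proof.
move=> irr.
pose pos := [set n | (0 < n)%N].
pose P := [set n | (0 < n)%N /\ reaches1 n].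
pose Q := [set n | (0 < n)%N /\ ~ reaches1 n].
have Ppos : P `<=` pos by move=> n [].
have Qpos : Q `<=` pos by move=> n [].
have PQ : P `&` Q = set0 by apply/seteqP; split=> // n [[_ ?] []].
have red : reducing_subspace dot (cstar_generated dot [set T1; T2])
    (closure (family_span e P)).
  apply: (@stabilizer_reducing _ _ _ _ _ (closure (family_span e Q))) => //.
  - exact: closed_subspace_span.
  - exact: closed_subspace_span.
  - move=> x; split=> [Px y Qy|xQ].
      exact: (disjoint_span_dot0 Hdot He Ppos Qpos PQ).
    rewrite (closure_span_orthogonal Hdot He Ppos) => n n0 nP.
    apply/xQ/subset_closure; apply: mem_span; split => // r; exact: nP.
  - move=> x; split=> [Qx y Py|xP].
      by apply: dot_eq0C; exact: (disjoint_span_dot0 Hdot He Ppos Qpos PQ).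
    rewrite (closure_span_orthogonal Hdot He Qpos) => n n0 nQ.
    apply/xP/subset_closure; apply: mem_span; split => //.
    by apply: contrapT => r; exact: nQ.
  - apply: span_collatz_stable => // n [n0 /reaches1_collatz rn].
    by split => //; exact: collatz_gt0.
  - apply: span_collatz_stable => // n [n0 rn].
    by split; [exact: collatz_gt0 | move=> /reaches1_collatz].
case: (irr _ red) => [M0|MT] n n0.
  have : closure (family_span e P) (e 1%N).
    by apply/subset_closure; apply: mem_span; split => //; exists 0%N.
  rewrite M0 => /(congr1 Num.norm); rewrite (norm_basis Hdot He) // normr0.
  by move=> /eqP; rewrite oner_eq0.
(* If the span were everything, [e n] would lie in it while being orthogonal to it, hence to
   itself. *)
apply: contrapT => rn.
have : closure (family_span e P) (e n) by rewrite MT.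
rewrite (closure_span_orthogonal Hdot He Ppos) => enP.
have /eqP : dot (e n) (e n) = 0 by apply: enP => // -[].
by rewrite (dot_basis He) // eqxx oner_eq0.
Qed.

(** The Collatz map is injective only on each parity class (1 and 8 both go to 4), which is why each
    operator is a partial isometry. *)
Lemma collatz_inj_odd : {in [pred n | odd n & (0 < n)%N] &, injective collatz}.
Proof.
by move=> m n /andP[om _] /andP[on _]; rewrite /collatz om on; lia.
Qed.

Lemma collatz_inj_even :
  {in [pred n | ~~ odd n & (0 < n)%N] &, injective collatz}.
Proof.
move=> m n /andP[om _] /andP[on _].
by rewrite /collatz (negbTE om) (negbTE on); lia.
Qed.

Lemma T2_basis' n : (0 < n)%N ->
  T2 (e n) = if ~~ odd n then e (collatz n) else 0.
Proof. by move=> n0; rewrite T2_basis //; case: odd. Qed.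

(* [loop] follows the cycle 1, 4, 2, 1; it fixes [e 1] and kills every other
   basis vector after finitely many steps, since (3 n + 1) / 4 < n for n > 1. *)
Let loop := T2 \o (T2 \o T1).

Lemma loop_basis n : (0 < n)%N -> loop (e n) =
  if odd n && ((3 * n + 1) %% 4 == 0)%N then e ((3 * n + 1) %/ 4)%N else 0.
Proof.
move=> n0; rewrite /loop /= T1e //; case: ifPn => on /=; last first.
  by rewrite !(lin0 bT2.1).
(* For odd [n] the number 3 n + 1 is even, so only the second [T2] can kill the vector. *)
rewrite T2e ?addn1 // -addn1; case: ifPn => o1; first by lia.
rewrite T2e; last by lia.
case: ifPn => o2; case: ifPn => //.
- by lia.
- by move=> _; congr e; lia.
- by lia.
Qed.

Lemma loop_contraction x : `|loop x| <= `|x|.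
Proof.
have T1c := shift_contraction collatz_gt0 collatz_inj_odd T1_basis bT1.
have T2c := shift_contraction collatz_gt0 collatz_inj_even T2_basis' bT2.
by rewrite (le_trans (T2c _)) // (le_trans (T2c _)).
Qed.

Lemma loop_linear : linear loop.
Proof. by apply: bounded_linear; do 2! apply: bounded_comp => //. Qed.

Lemma iter_loop_linear m : linear (iter m loop).
Proof. by elim: m => // m IH a x y; rewrite !iterS IH loop_linear. Qed.

Lemma iter_loop_contraction m x : `|iter m loop x| <= `|x|.
Proof.
by elim: m => // m IH; rewrite iterS (le_trans (loop_contraction _)).
Qed.

(** The right-hand side is the projection onto the line of [e 1]. Asking for all [m] from [N] on
    lets finite combinations take the maximum of their thresholds. *)
Lemma loop_basis_eventually n : (0 < n)%N -> exists N, forall m, (N <= m)%N ->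
  iter m loop (e n) = dot (e n) (e 1%N) *: e 1%N.
Proof.
elim/ltn_ind: n => n IH n0; rewrite (dot_basis He) //.
have [->|n1] := eqVneq n 1%N.
  exists 0%N => m _; rewrite scale1r; elim: m => //= m ->.
  by rewrite loop_basis.
rewrite scale0r; have := loop_basis n0; case: ifP => [/andP[on n4]|_] ln.
  have [||N Nm] := IH ((3 * n + 1) %/ 4)%N; [lia|lia|].
  exists N.+1 => -[|m] //; rewrite ltnS => /Nm.
  rewrite iterSr ln => ->; rewrite (dot_basis He) //; last by lia.
  by case: eqP => [|_]; [lia | rewrite scale0r].
exists 1%N => -[|m] // _; rewrite iterSr ln.
exact/lin0/iter_loop_linear.
Qed.

Lemma loop_span_eventually z : family_span e [set n | (0 < n)%N] z ->
  exists N, forall m, (N <= m)%N -> iter m loop z = dot z (e 1%N) *: e 1%N.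
Proof.
move: z; apply: span_min => [|n]; last exact: loop_basis_eventually.
split=> [|a x y [N Nx] [N' Ny]].
  exists 0%N => m _; rewrite linear0l scale0r.
  exact/lin0/iter_loop_linear.
exists (maxn N N') => m; rewrite geq_max => /andP[Nm N'm].
by rewrite iter_loop_linear Nx // Ny // dotDZl scalerDl scalerA.
Qed.

Lemma loop_invariant_basis1 (M : set H) x : closed_subspace M ->
  (forall y, M y -> M (loop y)) -> M x -> dot x (e 1%N) != 0 -> M (e 1%N).
Proof.
move=> [sM cM] Mloop Mx x1.
suff : M (dot x (e 1%N) *: e 1%N).
  move=> /(subspaceZ sM (dot x (e 1%N))^-1).
  by rewrite scalerA mulVf // scale1r.
apply: (closed_dist cM) => eps eps0.
have /closure_dist/(_ (eps / 2)) :
    closure (family_span e [set n | (0 < n)%N]) x.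
  by rewrite /family_span He.2.
case=> [|z /loop_span_eventually[N /(_ N (leqnn N)) Nz] xz].
  by rewrite divr_gt0.
exists (iter N loop x).
  by elim: N {Nz} => //= N; apply: Mloop.
(* With P the projection onto [e 1] and W = [loop]: P x - W^N x = P (x - z) + W^N (z - x), because P
   z = W^N z. Both terms have norm at most |x - z| < eps / 2. *)
rewrite -(subrK (iter N loop z) (_ *: _)) {1}Nz -scalerBl -linearBl -addrA.
rewrite -(linB (iter_loop_linear N)) (le_lt_trans (ler_normD _ _)) //.
rewrite [ltRHS]splitr ltrD // (le_lt_trans _ xz) //.
  rewrite normrZ (norm_basis Hdot He) // mulr1.
  rewrite (le_trans (cauchy_schwarz Hdot _ _)) //.
  by rewrite (norm_basis Hdot He) // mulr1.
by rewrite (le_trans (iter_loop_contraction _ _)) // distrC.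
Qed.

Lemma collatz_irreducible : collatz_conjecture ->
  no_nontrivial_reducing_subspace dot (cstar_generated dot [set T1; T2]).
Proof.
move=> collatzP M [sM cM MA MA'].
have A1 : cstar_generated dot [set T1; T2] T1 by move=> A [_]; apply; left.
have A2 : cstar_generated dot [set T1; T2] T2 by move=> A [_]; apply; right.
have [T1' TT1] := adjoint_exists Hdot He bT1.
have [T2' TT2] := adjoint_exists Hdot He bT2.
have M1 x : M x -> M (T1 x) by move=> Mx; apply: (MA _ A1); exists x.
have M2 x : M x -> M (T2 x) by move=> Mx; apply: (MA _ A2); exists x.
have M1' x : M x -> M (T1' x) by move=> Mx; apply: (MA' _ _ A1 TT1); exists x.
have M2' x : M x -> M (T2' x) by move=> Mx; apply: (MA' _ _ A2 TT2); exists x.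
(* The parity of [n] selects the operator whose adjoint takes the Collatz step at [n] back. *)
have back n : (0 < n)%N -> exists2 S, S = T1 \/ S = T2 &
    forall S', is_adjoint dot S S' -> S' (e (collatz n)) = e n.
  move=> n0; have [on|en] := boolP (odd n).
    exists T1; first by left.
    move=> S' SS'; exact: (shift_adjoint collatz_gt0 collatz_inj_odd T1_basis).
  exists T2; first by right.
  move=> S' SS'.
  exact: (shift_adjoint collatz_gt0 collatz_inj_even T2_basis').
have [[x Mx x1]|Mperp] := pselect (exists2 x, M x & dot x (e 1%N) != 0).
  right; apply: (basis_total He) => // n n0.
  have Me1 : M (e 1%N).
    by apply: loop_invariant_basis1 Mx x1 => // y My; apply/M2/M2/M1.
  (* Climb from [e 1] back along the orbit to [e n], one adjoint at a time. *)
  have [m] := collatzP n n0; elim: m n n0 => [|m IH] n n0.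
    by move=> /= ->.
  rewrite iterSr => /(IH _ (collatz_gt0 n0)) Mc.
  have [S [-> eS|-> eS]] := back n n0.
    by rewrite -(eS _ TT1); apply: M1'.
  by rewrite -(eS _ TT2); apply: M2'.
left; apply/seteqP; split=> [x Mx|_ ->]; last by case: sM.
apply: (basis_dot_ext Hdot He) => n n0; rewrite linear0l.
(* The vector [x] is generalized because <x, e_n> = <S x, e_(collatz n)> replaces it by [S x], again
   in [M]. *)
have [m] := collatzP n n0; elim: m n n0 x Mx => [|m IH] n n0 x Mx.
  by move=> /= ->; apply: contrapT => /eqP x1; apply: Mperp; exists x.
rewrite iterSr => /(IH _ (collatz_gt0 n0)) Mc.
have [S [-> eS|-> eS]] := back n n0.
  by rewrite -(eS _ TT1) -TT1 Mc //; apply: M1.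
by rewrite -(eS _ TT2) -TT2 Mc //; apply: M2.
Qed.

End CollatzOperators.

Unset Implicit Arguments.

Theorem theorem4p2p7 (R : realType) (H : completeNormedModType R[i])
    (dot : {dot H for @Num.conj R[i]}) (Hdot : norm_of_inner dot)
    (e : nat -> H) (He : orthonormal_basis dot [set n | (0 < n)%N] e)
    (T1 T2 : H -> H) (HT1 : bounded_operator T1) (HT2 : bounded_operator T2)
    (T1e : forall n : nat, (0 < n)%N ->
       T1 (e n) = if odd n then e (3 * n + 1)%N else 0)
    (T2e : forall n : nat, (0 < n)%N ->
       T2 (e n) = if odd n then 0 else e n./2) :
  no_nontrivial_reducing_subspace dot (cstar_generated dot [set T1; T2]) <->
  collatz_conjecture.
Proof.
split; first exact: (irreducible_collatz Hdot He HT1 HT2 T1e T2e).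
exact: (collatz_irreducible Hdot He HT1 HT2 T1e T2e).
Qed.
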